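(* Let $m\ge n\ge 1$ be integers and let $G=K_{m,n}$ be the complete bipartite graph on the vertex set $\{1,\ldots,m\}\cup\{m+1,\ldots,m+n\}$. Then for every integer $t\ge 0$, $$\beta_{t,t+2}(\mathrm{in}_<(J_G))=\sum_{\substack{1\le i\le m\\ m+1\le j\le m+n}}\binom{i+j-m-2}{t},$$ and $$\beta_{t,t+3}(\mathrm{in}_<(J_G))=\begin{cases}\displaystyle\sum_{\substack{1\le i<j\le m\\ 1\le k\le n}}\binom{n+k+j-3}{t}, & \text{if } n=1,\\[3ex] \displaystyle\sum_{\substack{1\le i<j\le m\\ 1\le k\le n}}\binom{n+k+j-3}{t}+\sum_{\substack{1\le i<j\le n\\ 1\le k\le m}}\binom{m+k+j-3}{t}, & \text{if } n>1.\end{cases}$$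
   Context: Let $K$ be a field and $S=K[x_1,\ldots,x_{m+n},y_1,\ldots,y_{m+n}]$ with the standard grading, and $<$ the lexicographic order on $S$ induced by $x_1>\cdots>x_{m+n}>y_1>\cdots>y_{m+n}$. The edges of $K_{m,n}$ are all pairs $\{i,j\}$ with $1\le i\le m$ and $m+1\le j\le m+n$. The binomial edge ideal $J_G\subset S$ of a simple graph $G$ is generated by the binomials $x_iy_j-x_jy_i$ with $\{i,j\}\in E(G)$, $i<j$; $\mathrm{in}_<(J_G)$ is its initial ideal with respect to $<$. For a finitely generated graded $S$-module $M$, $\beta_{i,j}(M)=\dim_K \mathrm{Tor}^S_i(M,K)_j$ are the graded Betti numbers. *)

(* Defs.v *)
From mathcomp Require Import all_boot all_order all_algebra.
From mathcomp Require Export mpoly.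

Set Implicit Arguments.
Unset Strict Implicit.
Unset Printing Implicit Defensive.

Import GRing.Theory.
Local Open Scope ring_scope.

Section Ideals.
Variables (K : fieldType) (N : nat).
Notation S := {mpoly K[N]}.

Definition ideal_gen (P : S -> Prop) (f : S) : Prop :=
  exists (r : nat) (c g : 'I_r -> S),
    (forall k, P (g k)) /\ f = \sum_(k < r) c k * g k.

(* Pure lexicographic order, with 'X_0 > 'X_1 > ... *)
Definition lex_lt (a b : 'X_{1..N}) : bool :=
  [exists k : 'I_N, (a k < b k)%N && [forall i : 'I_N, (i < k)%N ==> (a i == b i)]].

(* The library's [mlead] is relative to a degree-compatible order, not to
   pure lex. *)
Definition lex_lead (f : S) (a : 'X_{1..N}) : Prop :=
  a \in msupp f /\ {in msupp f, forall b, b != a -> lex_lt b a}.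

Definition initial_ideal (I : S -> Prop) : S -> Prop :=
  ideal_gen (fun g => exists f a, [/\ I f, lex_lead f a & g = 'X_[a]]).

(* A sequence of matrices
     ... -> F_2 -> F_1 -> F_0 -> S,   F_p = \bigoplus_(k < rk p) S(- shift p k),
   acting on row vectors by right multiplication.  The last map is [aug]. *)
Record free_seq := FreeSeq {
  rk : nat -> nat;
  shift : forall p, 'I_(rk p) -> nat;
  dmat : forall p, 'M[S]_(rk p.+1, rk p);
  aug : 'cV[S]_(rk 0)
}.
Arguments shift : clear implicits.
Arguments dmat : clear implicits.

(* The entry [f] of a degree-0 map S(-a) -> S(-b). *)
Definition homog_entry (a b : nat) (f : S) : Prop :=
  {in msupp f, forall u, (mdeg u + b)%N = a}.

Definition graded_free_resolution (F : free_seq) (I : S -> Prop) : Prop :=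
  [/\ forall k, homog_entry (shift F 0 k) 0 (aug F k 0),
      forall p k l, homog_entry (shift F p.+1 k) (shift F p l) (dmat F p k l),
      forall f, I f <-> exists u : 'rV_(rk F 0), f = (u *m aug F) 0 0,
      forall u : 'rV_(rk F 0),
        u *m aug F = 0 <-> exists v : 'rV_(rk F 1), u = v *m dmat F 0
    & forall p (u : 'rV_(rk F p.+1)),
        u *m dmat F p = 0 <-> exists v : 'rV_(rk F p.+2), u = v *m dmat F p.+1].

(* The complex F \otimes_S K, where K = S / (all variables): F_p \otimes K is
   K^(rk p), and tensoring a matrix keeps the constant terms of its entries. *)
Definition tensK (F : free_seq) (p : nat) : 'M[K]_(rk F p.+1, rk F p) :=
  \matrix_(k, l) (dmat F p k l)@_0%MM.

(* Its row space is the degree-j component of F_p \otimes K. *)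
Definition degree_part (F : free_seq) (p j : nat) : 'M[K]_(rk F p) :=
  diag_mx (\row_k (shift F p k == j)%:R).

Definition cycles (F : free_seq) (p j : nat) : 'M[K]_(rk F p) :=
  match p with
  | 0 => degree_part F 0 j
  | q.+1 => (degree_part F q.+1 j :&: kermx (tensK F q))%MS
  end.

Definition boundaries (F : free_seq) (p j : nat) : 'M[K]_(rk F p.+1, rk F p) :=
  degree_part F p.+1 j *m tensK F p.

(* The subtraction is exact: boundaries lie in cycles when F is a resolution. *)
Definition dim_Tor (F : free_seq) (p j : nat) : nat :=
  (\rank (cycles F p j) - \rank (boundaries F p j))%N.

(* \beta_{p,j}(I) = b.  Tor does not depend on the chosen resolution, which
   exists since S is Noetherian. *)
Definition graded_betti (I : S -> Prop) (p j b : nat) : Prop :=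
  exists F : free_seq, graded_free_resolution F I /\ dim_Tor F p j = b.

End Ideals.

Section BinomialEdgeIdeal.
Variables (K : fieldType) (v : nat).

(* The variables x_1, ..., x_v come first, then y_1, ..., y_v. *)
Definition xvar (i : 'I_v) : {mpoly K[v + v]} := 'X_(lshift v i).
Definition yvar (i : 'I_v) : {mpoly K[v + v]} := 'X_(rshift v i).

Definition binomial_edge_ideal (e : rel 'I_v) : {mpoly K[v + v]} -> Prop :=
  ideal_gen (fun g => exists i j : 'I_v,
    [/\ e i j, (i < j)%N & g = xvar i * yvar j - xvar j * yvar i]).

End BinomialEdgeIdeal.
Arguments binomial_edge_ideal : clear implicits.

(* Vertices are numbered from 0: the two sides are {0..m-1} and {m..m+n-1}. *)
Definition complete_bipartite (m n : nat) : rel 'I_(m + n) :=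
  fun i j => ((i < m) && (m <= j) || (j < m) && (m <= i))%N.
Arguments complete_bipartite : clear implicits.

(* Main.v *)
Require Import Defs.
From mathcomp Require Import all_boot all_order all_algebra.
From mathcomp Require Import ring zify.

(** The reduced lexicographic Groebner basis of the binomial edge ideal of
    K_(m,n) has as leading monomials the x_i y_j for the edges {i,j}, together
    with the cubics x_i y_j z_k attached to the paths i, k, j of length two:
    i < j lie on one side, k on the other, and z_k is x_k or y_k according to
    whether k is larger or smaller than both.  These monomials, listed in a
    suitable order, have linear quotients, so their Betti numbers can be read
    off from the colon ideals.

    Leading monomials.  The cubics are leading monomials of elements of the ideal
    by the Pluecker relation among the 2-minors of three columns ([lead_gen]).
    No S-polynomials are needed for the converse: the ideal lies in the three
    primes generated by all 2-minors, by the variables of one side, and by the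
    variables of the other side.  Hence a leading monomial contains some x_i y_j
    with i < j ([lead_inversion], by the toric parametrisation of the
    2-minors) and a variable from each side ([edge_cover]), which forces
    divisibility by one of the listed monomials ([initial_bipartite]).

    Resolutions.  If F resolves I and H resolves the colon ideal I : w, then the
    mapping cone of a lift H -> F of multiplication by w resolves I + (w)
    ([cone_resolution]).  When I : w is generated by variables and the generators
    of I have degree at most that of w, the cone is again minimal, for degree
    reasons ([resolved_add]).  The same step, applied to one variable at a time,
    resolves the ideal of q variables and gives the numbers C(q, p + 1)
    ([resolved_vars]).  Adding the generators w one by one, each contributes
    C(q, p) in degree p + deg w, where q is the number of variables generating
    its colon ideal ([linear_quotients]).  The theorem follows by counting these
    variables ([card_colon]) and summing over the generators of degree two and
    of degree three. *)

Set Implicit Arguments.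
Unset Strict Implicit.
Unset Printing Implicit Defensive.

Import GRing.Theory.

(** * Homogeneous entries of matrices over the polynomial ring *)

Section Homogeneity.
Local Open Scope ring_scope.
Variables (K : fieldType) (N : nat).
Notation S := {mpoly K[N]}.
Implicit Types (a b c : nat) (f g : S).

(** The condition is written with a sum, and not with the degree [a - b], so
    that the result is 0 when [a < b]. *)
Definition homog_part a b g : S :=
  \sum_(u <- msupp g | (mdeg u + b == a)%N) g@_u *: 'X_[u].

Lemma mcoeff_homog_part a b g u :
  (homog_part a b g)@_u = if (mdeg u + b == a)%N then g@_u else 0.
Proof.
rewrite /homog_part raddf_sum /=; under eq_bigr do rewrite mcoeffZ mcoeffX.
case: (boolP (u \in msupp g)) => [ug|/[dup] ug]; last first.
  move=> /memN_msupp_eq0 ->; rewrite if_same big_seq_cond big1 // => w /andP[wg _].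
  case: eqP => [wu|_]; last by rewrite mulr0.
  by move: wg; rewrite wu (negbTE ug).
case: ifP => [ua|ua].
  rewrite (big_rem _ ug) /= ua eqxx mulr1 big_seq_cond big1 ?addr0 // => w /andP[].
  by rewrite mem_rem_uniq ?msupp_uniq // inE => /andP[/negbTE -> _]; rewrite mulr0.
rewrite big1 // => w wa; case: eqP => [wu|_]; last by rewrite mulr0.
by move: wa; rewrite wu ua.
Qed.

Lemma homog_entryP a b f :
  homog_entry a b f <-> forall u, f@_u != 0 -> (mdeg u + b)%N = a.
Proof.
split=> h u; first by rewrite -mcoeff_msupp => /h.
by rewrite mcoeff_msupp => /h.
Qed.

Lemma homog_entry_part a b g : homog_entry a b (homog_part a b g).
Proof.
apply/homog_entryP => u; rewrite mcoeff_homog_part.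
by case: ifP => [/eqP //|_]; rewrite eqxx.
Qed.

Lemma homog_part_id a b g : homog_entry a b g -> homog_part a b g = g.
Proof.
move=> /homog_entryP h; apply/mpolyP => u; rewrite mcoeff_homog_part.
by case: ifP => // /eqP nu; case: (eqVneq g@_u 0) => // /h.
Qed.

Lemma homog_part_sum a b I (r : seq I) (P : pred I) (F : I -> S) :
  homog_part a b (\sum_(i <- r | P i) F i) = \sum_(i <- r | P i) homog_part a b (F i).
Proof.
apply/mpolyP => u; rewrite mcoeff_homog_part !raddf_sum /=.
under [RHS]eq_bigr do rewrite mcoeff_homog_part.
by case: ifP => // _; rewrite big1.
Qed.

(** Every monomial of f has the same degree, so multiplication by f moves the
    graded components of g without mixing them. *)
Lemma homog_partM a b c g f : homog_entry b c f ->
  homog_part a c (g * f) = homog_part a b g * f.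
Proof.
move=> /homog_entryP hf; apply/mpolyP => u; rewrite mcoeff_homog_part !mcoeffM.
transitivity (\sum_(k : 'X_{1..N < (mdeg u).+1, (mdeg u).+1} | u == (k.1 + k.2)%MM)
  if (mdeg u + c == a)%N then g@_k.1 * f@_k.2 else 0).
  by case: ifP => // _; rewrite big1.
apply: eq_bigr => k /eqP uk; rewrite mcoeff_homog_part.
have [->|/hf e] := eqVneq f@_k.2 0; first by rewrite !mulr0 if_same.
have -> : (mdeg u + c = mdeg k.1 + b)%N by rewrite -e addnA -mdegD -uk.
by case: ifP; rewrite ?mul0r.
Qed.

Lemma homog_entry0 a b : homog_entry a b (0 : S).
Proof. by move=> u; rewrite msupp0. Qed.

Lemma homog_entryN a b f : homog_entry a b f -> homog_entry a b (- f).
Proof. by move=> h u; rewrite (perm_mem (msuppN f)); apply: h. Qed.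

Lemma homog_entryM a b c f g :
  homog_entry a b f -> homog_entry b c g -> homog_entry a c (f * g).
Proof.
move=> hf hg; rewrite -[f in f * g](homog_part_id hf) -(homog_partM _ _ hg).
exact: homog_entry_part.
Qed.

Lemma homog_entry_sum a b I (r : seq I) (P : pred I) (F : I -> S) :
  (forall i, P i -> homog_entry a b (F i)) ->
  homog_entry a b (\sum_(i <- r | P i) F i).
Proof.
move=> h; apply/homog_entryP => u; rewrite raddf_sum /=.
case: (eqVneq (mdeg u + b)%N a) => // ne; rewrite big1 ?eqxx // => i.
by move=> /h /homog_entryP hi; apply/eqP; apply: contraNT ne => /hi ->.
Qed.

Lemma homog_entry_shift a b d f :
  homog_entry a b f -> homog_entry (a + d) (b + d) f.
Proof. by move=> h u /h; rewrite addnA => ->. Qed.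

(** A homogeneous map that raises degrees vanishes modulo the variables: this is
    the only source of minimality below. *)
Lemma homog_const_eq0 a b f : homog_entry a b f -> (b < a)%N -> f@_0%MM = 0.
Proof.
move=> /homog_entryP h ba; apply/eqP; apply: contraTT ba => /h.
by rewrite mdeg0 add0n => ->; rewrite ltnn.
Qed.

(** Degree-0 maps between the graded free modules whose bases sit in the degrees
    [sr] and [ss]. *)
Definition homog_mx r s (sr : 'I_r -> nat) (ss : 'I_s -> nat)
    (M : 'M[S]_(r, s)) :=
  forall k l, homog_entry (sr k) (ss l) (M k l).

Lemma homog_mxM r s t (sr : 'I_r -> nat) (ss : 'I_s -> nat) (st : 'I_t -> nat)
    (A : 'M[S]_(r, s)) (B : 'M[S]_(s, t)) :
  homog_mx sr ss A -> homog_mx ss st B -> homog_mx sr st (A *m B).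
Proof.
move=> hA hB k l; rewrite mxE; apply: homog_entry_sum => i _.
exact: homog_entryM (hA _ _) (hB _ _).
Qed.

(** Row-wise lifts through B need not be homogeneous, but their components of the
    right degrees are again lifts, because taking components commutes with
    multiplication by the homogeneous entries of B. *)
Lemma homog_lift r s t (sr : 'I_r -> nat) (ss : 'I_s -> nat) (st : 'I_t -> nat)
    (A : 'M[S]_(r, t)) (B : 'M[S]_(s, t)) :
    homog_mx sr st A -> homog_mx ss st B ->
    (forall k, exists v, row k A = v *m B) ->
  {C : 'M[S]_(r, s) | homog_mx sr ss C & C *m B = A}.
Proof.
move=> hA hB ex.
have {}ex k : exists v, row k A == v *m B by case: (ex k) => v ->; exists v.
pose v k := sval (sigW (ex k)).
have vE k : row k A = v k *m B by apply/eqP; apply: (svalP (sigW (ex k))).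
exists (\matrix_(k, l) homog_part (sr k) (ss l) (v k 0 l)).
  by move=> k l; rewrite mxE; apply: homog_entry_part.
apply/matrixP => k l; rewrite mxE.
have -> : A k l = homog_part (sr k) (st l) ((v k *m B) 0 l).
  by rewrite -vE mxE homog_part_id.
rewrite mxE homog_part_sum; apply: eq_bigr => i _.
by rewrite mxE (homog_partM _ _ (hB _ _)).
Qed.

End Homogeneity.

(** * Mapping cones of graded free resolutions *)

Section Resolutions.
Local Open Scope ring_scope.
Variables (K : fieldType) (N : nat).
Notation S := {mpoly K[N]}.
Implicit Types (F H : free_seq K N) (I J : S -> Prop) (p d : nat).

(** The complex F with S added at its end, so that F_(p-1) sits in position p;
    this is a resolution of S/I, and it treats the augmentation and the other
    maps alike. *)
Definition augrk F p : nat := if p is q.+1 then rk F q else 1%N.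

Definition augd F p : 'M[S]_(rk F p, augrk F p) :=
  if p is q.+1 then dmat F q else aug F.

Definition augshift F p : 'I_(augrk F p) -> nat :=
  if p is q.+1 then @shift K N F q else fun=> 0%N.

Lemma resolutionP F I : graded_free_resolution F I <->
  [/\ forall p, homog_mx (@shift K N F p) (@augshift F p) (augd F p),
      forall f, I f <-> exists u : 'rV_(rk F 0), f = (u *m aug F) 0 0
    & forall p (u : 'rV_(rk F p)),
        u *m augd F p = 0 <-> exists v : 'rV_(rk F p.+1), u = v *m dmat F p].
Proof.
split=> [[h0 hS im e0 eS]|[h im e]].
  split=> // [[|p] k l|[|p] u]; [by rewrite ord1; apply: h0|exact: hS|..].
    exact: e0.
  exact: eS.
split=> [k|p|||p] //; first exact: (h 0%N k 0).
- exact: (h p.+1).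
- exact: (e 0%N).
- exact: (e p.+1).
Qed.

Lemma dmatK F I p : graded_free_resolution F I ->
  dmat F p *m augd F p = 0.
Proof.
move=> /resolutionP[_ _ e]; apply/row_matrixP => k.
rewrite row0 row_mul; apply/e; exists (delta_mx 0 k).
by rewrite rowE.
Qed.

Lemma aug_in F I k : graded_free_resolution F I -> I (aug F k 0).
Proof.
move=> /resolutionP[_ im _]; apply/im; exists (delta_mx 0 k).
by rewrite -rowE mxE.
Qed.

(** Multiplication by w maps J into I, hence lifts to the resolutions one
    homological degree at a time. *)
Lemma comparison_maps F H I J d (w : S) :
    graded_free_resolution F I -> graded_free_resolution H J ->
    homog_entry d 0 w -> (forall f, J f <-> I (w * f)) ->
  exists phi : forall p, 'M[S]_(rk H p, rk F p),
  [/\ forall p, homog_mx (fun k => shift k + d)%N (@shift K N F p) (phi p),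
      phi 0%N *m aug F = w *: aug H
    & forall p, phi p.+1 *m dmat F p = dmat H p *m phi p].
Proof.
move=> resF resH hw IJ.
have [hF imF eF] := (resolutionP _ _).1 resF.
have [hH imH eH] := (resolutionP _ _).1 resH.
(* The equation in [good] makes the next lifting step possible. *)
pose good p (M : 'M[S]_(rk H p, rk F p)) :=
  homog_mx (fun k => shift k + d)%N (@shift K N F p) M /\
  dmat H p *m M *m augd F p = 0.
have base : {M | good 0%N M & M *m aug F = w *: aug H}.
  have hA : homog_mx (fun k => shift k + d)%N (fun=> 0%N) (w *: aug H).
    move=> k l; rewrite mxE mulrC; apply: homog_entryM hw.
    by have := homog_entry_shift d (hH 0%N k l); rewrite /= add0n.
  have ex k : exists v, row k (w *: aug H) = v *m aug F.
    have /imF[v vE] : I (w * aug H k 0) by apply/IJ; apply: aug_in resH.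
    by exists v; apply/rowP=> l; rewrite !mxE !ord1 vE mxE.
  have [M hM ME] := homog_lift hA (hF 0%N) ex.
  exists M => //; split=> //; rewrite -mulmxA /= ME -scalemxAr.
  by have /= -> := dmatK 0 resH; rewrite scaler0.
have step p (M : {M | @good p M}) :
    {M' | good p.+1 M' & M' *m dmat F p = dmat H p *m sval M}.
  case: M => M [hM M0] /=.
  have hA := homog_mxM (fun k l => homog_entry_shift d (hH p.+1 k l)) hM.
  have ex k : exists v, row k (dmat H p *m M) = v *m dmat F p.
    by apply/eF; rewrite -row_mul M0 row0.
  have [M' hM' ME] := homog_lift hA (hF p.+1) ex.
  exists M' => //; split=> //; rewrite -mulmxA /= ME mulmxA.
  by have /= -> := dmatK p.+1 resH; rewrite mul0mx.
pose phi : forall p, {M | @good p M} := nat_rect (fun p => {M | @good p M})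
  (exist _ (s2val base) (s2valP base))
  (fun p M => exist _ (s2val (step p M)) (s2valP (step p M))).
exists (fun p => sval (phi p)); split=> [p||p].
- by case: (svalP (phi p)).
- exact: (s2valP' base).
- exact: (s2valP' (step p (phi p))).
Qed.

Definition shiftD r s (a : 'I_r -> nat) (b : 'I_s -> nat) (k : 'I_(r + s)) :=
  match split k with inl i => a i | inr j => b j end.

Lemma shiftDl r s (a : 'I_r -> nat) (b : 'I_s -> nat) i :
  shiftD a b (lshift s i) = a i.
Proof. by rewrite /shiftD (unsplitK (inl i)). Qed.

Lemma shiftDr r s (a : 'I_r -> nat) (b : 'I_s -> nat) i :
  shiftD a b (rshift r i) = b i.
Proof. by rewrite /shiftD (unsplitK (inr i)). Qed.

(** The cone of the lift, to the augmented complexes, of multiplication by w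
    from (S/J)(-d) to S/I; the sign in the last block makes consecutive maps
    compose to 0. *)
Definition cone F H d (w : S) (phi : forall p, 'M[S]_(rk H p, rk F p)) :
    free_seq K N :=
  @FreeSeq K N (fun p => rk F p + augrk H p)%N
    (fun p => shiftD (@shift K N F p) (fun k => @augshift H p k + d)%N)
    (fun p => block_mx (dmat F p) 0 (phi p) (- augd H p))
    (col_mx (aug F) w%:M).

(** This is the exact sequence 0 -> I -> I + (w) -> (S/J)(-d) -> 0.  In a cycle
    (a, b) of the cone, b is a cycle of the resolution of S/J, hence a
    boundary, the image of some c; then [a + c *m phi] is a cycle of F, hence the
    image of some e, and (e, -c) maps to (a, b). *)
Lemma cone_resolution F H I J d (w : S) phi :
    graded_free_resolution F I -> graded_free_resolution H J ->
    homog_entry d 0 w -> (forall f, J f <-> I (w * f)) ->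
    (forall p, homog_mx (fun k => shift k + d)%N (@shift K N F p) (phi p)) ->
    phi 0%N *m aug F = w *: aug H ->
    (forall p, phi p.+1 *m dmat F p = dmat H p *m phi p) ->
  graded_free_resolution (cone d w phi)
    (fun f => exists g h, I g /\ f = g + h * w).
Proof.
move=> resF resH hw IJ hphi phi0 phiS.
have [hF imF eF] := (resolutionP _ _).1 resF.
have [hH imH eH] := (resolutionP _ _).1 resH.
have dF p := dmatK p resF; have dH p := dmatK p resH.
apply/resolutionP; split=> [[|p] k l|f|[|p] u].
- rewrite /= !ord1; case: (split_ordP k) => i ->.
    by rewrite shiftDl col_mxEu; apply: (hF 0%N i 0).
  by rewrite shiftDr col_mxEd mxE !ord1 eqxx mulr1n.
- rewrite /=; case: (split_ordP k) => i ->; case: (split_ordP l) => j ->;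
    rewrite ?shiftDl ?shiftDr.
  + by rewrite block_mxEul; apply: (hF p.+1).
  + by rewrite block_mxEur mxE; apply: homog_entry0.
  + by rewrite block_mxEdl; apply: hphi.
  + rewrite block_mxEdr mxE; apply/homog_entryN/homog_entry_shift.
    exact: hH.
- split=> [[g [h [/imF[v ->] ->]]]|[u ->]].
    exists (row_mx v h%:M); rewrite mul_row_col [RHS]mxE; congr (_ + _).
    by rewrite -scalar_mxM mxE eqxx mulr1n.
  exists ((lsubmx u *m aug F) 0 0), (u 0 (rshift _ 0)).
  split; first by apply/imF; exists (lsubmx u).
  rewrite -[u in LHS]hsubmxK mul_row_col [LHS]mxE; congr (_ + _).
  by rewrite mxE big_ord1 !mxE eqxx mulr1n.
- rewrite -[u]hsubmxK; move: (lsubmx u) (rsubmx u) => a b /=.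
  rewrite mul_row_col; split=> [ab0|[v]]; last first.
    rewrite -[v]hsubmxK mul_row_block mulmx0 add0r => /eq_row_mx[-> ->].
    rewrite mulmxDl -!mulmxA /= (dF 0%N) phi0 mulmx0 add0r.
    by rewrite mulNmx mul_mx_scalar mulmxN subrr.
  have /imH[c bE] : J (b 0 0).
    apply/IJ/imF; exists (- a).
    move/eqP: ab0; rewrite addr_eq0 => /eqP aE.
    by rewrite mulNmx aE opprK mul_mx_scalar mxE.
  have {}bE : b = c *m aug H by apply/rowP => k; rewrite ord1.
  have /(eF 0%N)[e eE] : (a + c *m phi 0%N) *m aug F = 0.
    by rewrite mulmxDl -mulmxA phi0 -scalemxAr -bE -mul_mx_scalar.
  exists (row_mx e (- c)); rewrite mul_row_block mulmx0 add0r.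
  by rewrite mulmxN !mulNmx opprK -bE -eE addrK.
- rewrite -[u]hsubmxK; move: (lsubmx u) (rsubmx u) => a b /=.
  rewrite mul_row_block mulmx0 add0r mulmxN; split=> [ab0|[v]]; last first.
    rewrite -[v]hsubmxK mul_row_block mulmx0 add0r => /eq_row_mx[-> ->].
    rewrite mulmxDl -!mulmxA (dF p.+1) mulmx0 add0r phiS.
    by rewrite !mulNmx !mulmxN subrr dH mulmx0 !oppr0 row_mx0.
  have [a0 b0] : a *m dmat F p + b *m phi p = 0 /\ - (b *m augd H p) = 0.
    by apply: eq_row_mx; rewrite ab0 row_mx0.
  have /(eH p)[c bE] : b *m augd H p = 0 by apply: oppr_inj; rewrite b0 oppr0.
  have /(eF p.+1)[e eE] : (a + c *m phi p.+1) *m dmat F p = 0.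
    by rewrite mulmxDl -mulmxA phiS mulmxA -bE.
  exists (row_mx e (- c)); rewrite mul_row_block mulmx0 add0r.
  by rewrite mulmxN !mulNmx opprK -bE -eE addrK.
Qed.

(** Maps without constant terms form a minimal resolution, and this is what makes
    the numbers [c p j] of basis elements Betti numbers. *)
Definition resolved I (c : nat -> nat -> nat) : Prop := exists F,
  [/\ graded_free_resolution F I,
      forall p k l, (dmat F p k l)@_0%MM = 0
    & forall p j, (\sum_(k < rk F p) (shift k == j :> nat) = c p j)%N].

Lemma resolved_ext I I' c c' :
  (forall f, I f <-> I' f) -> (forall p j, c p j = c' p j) ->
  resolved I c -> resolved I' c'.
Proof.
move=> II cc [F [[h0 h im e0 e] mF sF]]; exists F; split=> //.
  by split=> // f; rewrite -II.
by move=> p j; rewrite sF cc.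
Qed.

Lemma resolved_shift c F p (k : 'I_(rk F p)) :
  (forall q j, (\sum_(i < rk F q) (shift i == j :> nat) = c q j)%N) ->
  (0 < c p (shift k))%N.
Proof. by move<-; rewrite (bigD1 k) //= eqxx. Qed.

(** The diagonal matrix is [B^T *m B], where B consists of the rows of the
    identity selected by [b]. *)
Lemma rank_diag_bool r (b : pred 'I_r) :
  \rank (diag_mx (\row_k (b k)%:R) : 'M[K]_r) = (\sum_k b k)%N.
Proof.
pose B : 'M[K]_(#|b|, r) := \matrix_(i, j) (enum_val i == j)%:R.
have Bfree : row_free B.
  apply/row_freeP; exists B^T; apply/matrixP => i j; rewrite !mxE.
  rewrite (bigD1 (enum_val i)) //= !mxE eqxx mul1r (inj_eq enum_val_inj) eq_sym.
  by rewrite big1 ?addr0 // => k /negbTE ki; rewrite !mxE eq_sym ki mul0r.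
have -> : diag_mx (\row_k (b k)%:R) = B^T *m B.
  apply/matrixP => i j; rewrite !mxE; case: (boolP (b i)) => bi.
    have [l le] : exists l : 'I_#|b|, enum_val l = i.
      by exists (enum_rank_in bi i); rewrite enum_rankK_in.
    rewrite (bigD1 l) //= !mxE le eqxx mul1r.
    rewrite big1 ?addr0 // => k kl; rewrite !mxE -le (inj_eq enum_val_inj).
    by rewrite (negbTE kl) mul0r.
  rewrite mul0rn big1 // => k _; rewrite !mxE; case: eqP => [e|]; rewrite ?mul0r //.
  by move: (enum_valP k); rewrite e unfold_in (negbTE bi).
rewrite mxrankMfree // mxrank_tr (eqP Bfree) -sum1_card big_mkcond /=.
by apply: eq_bigr => k _; rewrite unfold_in; case: (b k).
Qed.

(** All maps of a minimal resolution vanish after tensoring with K, so Tor has the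
    same graded dimensions as the free modules. *)
Lemma resolved_betti I c p j : resolved I c -> graded_betti I p j (c p j).
Proof.
move=> [F [res mF sF]]; exists F; split=> //.
have t0 q : tensK F q = 0 by apply/matrixP=> k l; rewrite !mxE mF.
have rk_deg q : \rank (degree_part F q j) = c q j.
  by rewrite -sF -rank_diag_bool.
rewrite /dim_Tor /boundaries t0 mulmx0 mxrank0 subn0.
case: p => [|p] /=; first exact: rk_deg.
by rewrite t0 -rk_deg (cap_eqmx (eqmx_refl _) (@kermx0 _ _ _)) capmx1.
Qed.

End Resolutions.

(** * Monomial ideals with linear quotients *)

Section MonomialIdeals.
Local Open Scope ring_scope.
Variables (K : fieldType) (N : nat).
Notation S := {mpoly K[N]}.
Implicit Types (P : pred 'X_{1..N}) (f g h : S) (a u : 'X_{1..N}).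

(** Describing a monomial ideal by its set of monomials turns sums and colons
    with a monomial into operations on predicates. *)
Definition mono_ideal P f : Prop := {in msupp f, forall u, P u}.

Lemma mono_ideal_ext P Q f : P =1 Q -> mono_ideal P f <-> mono_ideal Q f.
Proof. by move=> PQ; split=> h u /h; rewrite PQ. Qed.

Lemma mono_colon P a f :
  mono_ideal (fun u => P (u + a)%MM) f <-> mono_ideal P ('X_[a] * f).
Proof.
rewrite mulrC; split=> h u.
  rewrite (perm_mem (msuppMX f a)) => /mapP[v vf ->].
  by rewrite addmC; apply: h.
move=> uf; apply: h; rewrite (perm_mem (msuppMX f a)) addmC.
by apply/mapP; exists u.
Qed.

Lemma mono_add P a f :
  mono_ideal (fun u => P u || (a <= u)%MM) f <->
  exists g h, mono_ideal P g /\ f = g + h * 'X_[a].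
Proof.
split=> [Pf|[g [h [Pg ->]]] u].
  exists (\sum_(u <- msupp f | P u) f@_u *: 'X_[u]).
  exists (\sum_(u <- msupp f | ~~ P u) f@_u *: 'X_[u - a]); split.
    move=> u /msupp_sum_le /flattenP[s /mapP[v]].
    by rewrite mem_filter => /andP[Pv _] -> /msuppZ_le; rewrite msuppX inE => /eqP->.
  rewrite mulr_suml [LHS]mpolyE (bigID P) /=; congr (_ + _).
  rewrite big_seq_cond [RHS]big_seq_cond; apply: eq_bigr => u /andP[uf nPu].
  rewrite -scalerAl -mpolyXD submK //.
  by move: (Pf u uf); rewrite (negbTE nPu).
move=> /msuppD_le; rewrite mem_cat => /orP[/Pg -> //|].
rewrite (perm_mem (msuppMX h a)) => /mapP[v _ ->].
by rewrite [(_ <= _)%MM]lem_addr ?lexx ?orbT.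
Qed.

(** The Betti numbers of an ideal generated by q variables. *)
Definition linear_betti q p j : nat := ((j == p.+1) * 'C(q, p.+1))%N.

(** The bound on c says that F_p lives in degrees at most [p + mdeg a], while the
    p-th module of the shifted linear resolution lives in degree
    [p + 1 + mdeg a]; so the comparison maps have no constant terms, and the
    cone is minimal. *)
Lemma resolved_add P a c q :
    resolved (mono_ideal P) c ->
    resolved (mono_ideal (fun u => P (u + a)%MM)) (linear_betti q) ->
    (forall p j, (p + mdeg a < j)%N -> c p j = 0%N) ->
  resolved (mono_ideal (fun u => P u || (a <= u)%MM))
    (fun p j => c p j + (j == p + mdeg a) * 'C(q, p))%N.
Proof.
move=> [F [resF mF sF]] [H [resH mH sH]] bnd.
have hw : homog_entry (mdeg a) 0 ('X_[a] : S).
  by move=> u; rewrite msuppX inE => /eqP ->; rewrite addn0.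
have [phi [hphi phi0 phiS]] :=
  comparison_maps resF resH hw (fun f => mono_colon P a f).
have resC := cone_resolution resF resH hw
  (fun f => mono_colon P a f) hphi phi0 phiS.
have shH p (k : 'I_(rk H p)) : shift k = p.+1.
  by have := resolved_shift k sH; rewrite /linear_betti; case: eqP.
have shF p (k : 'I_(rk F p)) : (shift k <= p + mdeg a)%N.
  by have := resolved_shift k sF; case: (leqP (shift k)) => // /bnd ->.
have [hF _ _] := (resolutionP _ _).1 resF.
have [hH _ _] := (resolutionP _ _).1 resH.
exists (cone (mdeg a) 'X_[a] phi); split.
- have [h0 h im e0 e] := resC; split=> // f.
  by rewrite mono_add; apply: im.
- move=> p k l /=; case: (split_ordP k) => i ->; case: (split_ordP l) => j ->.
  + by rewrite block_mxEul.
  + by rewrite block_mxEur mxE mcoeff0.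
  + rewrite block_mxEdl; apply: homog_const_eq0 (hphi p i j) _.
    by rewrite shH addSn ltnS.
  + rewrite block_mxEdr mxE mcoeffN; apply/eqP; rewrite oppr_eq0; apply/eqP.
    apply: homog_const_eq0 (hH p i j) _; rewrite shH.
    by case: p i j {k l} => //= p i j; rewrite shH.
- move=> p j; rewrite /= big_split_ord /=.
  under eq_bigr do rewrite shiftDl.
  rewrite sF; congr addn; under eq_bigr do rewrite shiftDr.
  case: p => [|p] /=; first by rewrite big_ord1 bin0 muln1 eq_sym.
  under eq_bigr do rewrite shH.
  rewrite big_const_ord iter_addn_0 mulnC eq_sym.
  case: eqP => _; last by rewrite muln0 mul0n.
  rewrite !mul1n; have := sH p p.+1; rewrite /linear_betti eqxx mul1n => <-.
  under eq_bigr do rewrite shH eqxx.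
  by rewrite sum_nat_const card_ord.
Qed.

Lemma resolved0 : resolved (mono_ideal xpred0) (fun _ _ => 0%N).
Proof.
exists (@FreeSeq K N (fun=> 0%N) (fun _ _ => 0%N) (fun _ => 0) 0).
split=> [|p []//|p j]; last by rewrite big_ord0.
split=> [[]//|p []//|f|u|p u].
- split=> [nf|[u ->]]; last by rewrite mulmx0 mxE => u0; rewrite msupp0.
  exists 0; rewrite mul0mx mxE; apply/mpolyP => u; rewrite mcoeff0.
  by apply/eqP; apply: contraT; rewrite -mcoeff_msupp => /nf.
- split=> _; last by rewrite mulmx0.
  by exists 0; rewrite [LHS]thinmx0 [RHS]thinmx0.
- by split=> _; [exists 0|]; rewrite [LHS]thinmx0 [RHS]thinmx0.
Qed.

(** Adding a variable x to an ideal generated by other variables leaves that ideal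
    unchanged under the colon by x, so the numbers satisfy Pascal's rule. *)
Lemma resolved_vars (W : {set 'I_N}) :
  resolved (mono_ideal (fun u => [exists i in W, 0 < u i]%N))
    (linear_betti #|W|).
Proof.
have [q Wq] : exists q, #|W| == q by exists #|W|.
elim: q W Wq => [|q IH] W; rewrite ?cards_eq0 => Wq.
  rewrite (eqP Wq) cards0; apply: resolved_ext resolved0 => [f|p j].
    apply: mono_ideal_ext => u; apply/esym/existsP => -[i].
    by rewrite inE.
  by rewrite /linear_betti muln0.
have /card_gt0P[x xW] : (0 < #|W|)%N by rewrite (eqP Wq).
have Wx : #|W :\ x| = q by have := cardsD1 x W; rewrite xW (eqP Wq) => -[].
have {}IH := IH _ (introT eqP Wx); rewrite Wx in IH.
rewrite (eqP Wq); apply: resolved_ext (@resolved_add _ U_(x)%MM _ q IH _ _).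
- move=> f; apply: mono_ideal_ext => u; apply/orP/existsP => [[]|].
  + by case/existsP => i /andP[]; rewrite inE => /andP[_ iW] ui; exists i; rewrite iW.
  + by rewrite lep1mP => ux; exists x; rewrite xW lt0n.
  + case=> i /andP[iW ui]; case: (eqVneq i x) => [ix|ix].
      by right; rewrite lep1mP -lt0n -ix.
    by left; apply/existsP; exists i; rewrite !inE ix iW.
- move=> p j; rewrite /linear_betti mdeg1 addn1 binS.
  by rewrite mulnDr.
- apply: resolved_ext IH => // f; apply: mono_ideal_ext => u.
  apply: eq_existsb => i; rewrite !inE mnmDE mnm1E.
  by case: (eqVneq i x) => //= _; rewrite addn0.
- move=> p j; rewrite mdeg1 addn1 /linear_betti; case: eqP => // ->.
  by rewrite ltnn.
Qed.

Definition sqfree_mnm (A : {set 'I_N}) : 'X_{1..N} := [multinom (i \in A : nat) | i < N].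

Definition mnm_supp u : {set 'I_N} := [set i | 0 < u i]%N.

Lemma sqfree_mnm_le A u : (sqfree_mnm A <= u)%MM = (A \subset mnm_supp u).
Proof.
apply/mnm_lepP/subsetP => h i; last first.
  by rewrite mnmE; case: (boolP (i \in A)) => // /h; rewrite inE.
by move=> iA; have := h i; rewrite mnmE iA inE.
Qed.

Lemma mdeg_sqfree_mnm A : mdeg (sqfree_mnm A) = #|A|.
Proof.
rewrite mdegE -sum1_card [RHS]big_mkcond /=; apply: eq_bigr => i _.
by rewrite mnmE; case: (i \in A).
Qed.

Lemma mnm_suppD u A : mnm_supp (u + sqfree_mnm A)%MM = mnm_supp u :|: A.
Proof.
by apply/setP => i; rewrite !inE mnmDE mnmE addn_gt0; case: (i \in A).
Qed.

(** Squarefree monomials [g x], added in the order of [key].  The last two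
    hypotheses say that the monomials before x have, modulo [g x], a colon
    ideal generated by the variables [V x]: every earlier monomial has one of
    these variables outside [g x], and each of them, times [g x], is divisible
    by an earlier monomial.  Generators must come in weakly increasing degree
    for the cones to remain minimal. *)
Lemma linear_quotients (T : finType) (valid : pred T) (key : T -> nat)
    (g V : T -> {set 'I_N}) :
    {in valid &, injective key} ->
    {in valid &, forall x y, key y < key x -> #|g y| <= #|g x|}%N ->
    {in valid &, forall x y, (key y < key x)%N ->
       exists i, [/\ i \in g y, i \notin g x & i \in V x]} ->
    {in valid, forall x i, i \in V x ->
       exists y, [/\ valid y, key y < key x & g y \subset i |: g x]%N} ->
  resolved
    (mono_ideal (fun u => [exists x, valid x && (g x \subset mnm_supp u)]))
    (fun p j => \sum_(x | valid x) (j == p + #|g x|) * 'C(#|V x|, p))%N.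
Proof.
move=> inj mono ha hb.
pose D n x := valid x && (key x < n)%N.
pose P n u := [exists x, D n x && (g x \subset mnm_supp u)].
pose c n p j := (\sum_(x | D n x) (j == p + #|g x|) * 'C(#|V x|, p))%N.
have main n : resolved (mono_ideal (P n)) (c n).
  elim: n => [|n IH].
    apply: resolved_ext resolved0 => [f|p j].
      apply: mono_ideal_ext => u; apply/esym/existsP => -[x].
      by rewrite /D ltn0 andbF.
    by rewrite /c big_pred0 // => x; rewrite /D ltn0 andbF.
  case: (pickP (fun x => valid x && (key x == n))) => [x /andP[vx /eqP kx]|no].
    have DS y : D n.+1 y = D n y || (y == x).
      rewrite /D ltnS leq_eqVlt; case: (eqVneq y x) => [->|yx].
        by rewrite vx kx eqxx orbT.
      rewrite orbF; case: (boolP (valid y)) => //= vy; case: eqP => //= ky.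
      by case/eqP: yx; apply: inj => //; rewrite ky kx.
    have Dx : D n x = false by rewrite /D kx ltnn andbF.
    apply: resolved_ext (@resolved_add _ (sqfree_mnm (g x)) _ #|V x| IH _ _).
    - move=> f; apply: mono_ideal_ext => u; rewrite sqfree_mnm_le.
      apply/orP/existsP => [[]|[y]].
      + by case/existsP=> y /andP[Dy gy]; exists y; rewrite DS Dy gy.
      + by move=> gx; exists x; rewrite DS eqxx orbT gx.
      + rewrite DS => /andP[/orP[Dy|/eqP->] gy]; last by right.
        by left; apply/existsP; exists y; rewrite Dy.
    - move=> p j; rewrite mdeg_sqfree_mnm /c [RHS](bigD1 x) ?DS ?eqxx ?orbT //= addnC.
      congr addn; apply: eq_bigl => y; rewrite DS.
      by case: (eqVneq y x) => [->|_]; rewrite ?Dx ?orbF ?andbT.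
    - apply: resolved_ext (resolved_vars (V x)) => // f.
      apply: mono_ideal_ext => u; rewrite /P mnm_suppD.
      apply/existsP/existsP => [[i /andP[iV ui]]|[y /andP[/andP[vy ky] gy]]].
        have [y [vy ky gy]] := hb x vx i iV.
        exists y; rewrite /D vy -kx ky; apply: subset_trans gy _.
        by rewrite subUset sub1set subsetUr !inE ui.
      have [i [iy ix iV]] : exists i, [/\ i \in g y, i \notin g x & i \in V x].
        by apply: ha; rewrite ?kx.
      exists i; rewrite iV; have := subsetP gy i iy.
      by rewrite inE (negbTE ix) orbF inE.
    - move=> p j; rewrite mdeg_sqfree_mnm => lt_j; apply: big1 => y /andP[vy ky].
      case: eqP => // jE; move: lt_j; rewrite jE ltn_add2l ltnNge.
      by rewrite mono ?kx.
  have DS y : D n.+1 y = D n y.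
    by rewrite /D ltnS leq_eqVlt; move: (no y); case: (valid y) => //= ->.
  apply: resolved_ext IH => [f|p j].
    by apply: mono_ideal_ext => u; apply: eq_existsb => y; rewrite DS.
  by apply: eq_bigl => y; rewrite DS.
pose n := (\max_x key x).+1.
have DE x : D n x = valid x by rewrite /D ltnS leq_bigmax andbT.
apply: resolved_ext (main n) => [f|p j].
  by apply: mono_ideal_ext => u; apply: eq_existsb => y; rewrite DE.
by apply: eq_bigl => y; rewrite DE.
Qed.

End MonomialIdeals.

(** * Leading monomials in binomial edge ideals *)

Section IdealGen.
Local Open Scope ring_scope.
Variables (K : fieldType) (N : nat).
Notation S := {mpoly K[N]}.
Implicit Types (G : S -> Prop) (P : pred 'X_{1..N}) (f g h : S).

Lemma ideal_gen0 G : ideal_gen G 0.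
Proof. by exists 0%N, (fun=> 0), (fun=> 0); split=> [[]|] //; rewrite big_ord0. Qed.

Lemma ideal_genM G c g : G g -> ideal_gen G (c * g).
Proof. by move=> Gg; exists 1%N, (fun=> c), (fun=> g); rewrite big_ord1. Qed.

Lemma ideal_genD G f g : ideal_gen G f -> ideal_gen G g -> ideal_gen G (f + g).
Proof.
move=> [r [c [a [Ga ->]]]] [s [d [b [Gb ->]]]].
exists (r + s)%N, (fun k => match split k with inl i => c i | inr i => d i end),
  (fun k => match split k with inl i => a i | inr i => b i end); split.
  by move=> k; case: (split k).
rewrite big_split_ord; congr (_ + _); apply: eq_bigr => i _ /=.
  by rewrite (unsplitK (inl i)).
by rewrite (unsplitK (inr i)).
Qed.

Lemma ideal_gen_sum G I (r : seq I) (F : I -> S) :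
  (forall i, ideal_gen G (F i)) -> ideal_gen G (\sum_(i <- r) F i).
Proof.
by move=> h; elim/big_ind: _ => //; [apply: ideal_gen0|move=> f g; apply: ideal_genD].
Qed.

Lemma ideal_gen_mono G P :
    (forall u w, P u -> P (w + u)%MM) -> (forall g, G g -> mono_ideal P g) ->
  forall f, ideal_gen G f -> mono_ideal P f.
Proof.
move=> Pup PG f [r [c [g [Gg ->]]]] u /msupp_sum_le /flattenP[s /mapP[k _ ->]].
move=> /msuppM_le /allpairsP[[w w'] /= [_ w'g ->]].
exact/Pup/(PG _ (Gg k)).
Qed.

Lemma mono_ideal_gen G P :
    (forall u, P u -> exists a, (a <= u)%MM /\ G 'X_[a]) ->
  forall f, mono_ideal P f -> ideal_gen G f.
Proof.
move=> PG f Pf; rewrite [f]mpolyE big_seq_cond big_mkcond /=.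
apply: ideal_gen_sum => u; rewrite andbT; case: (boolP (u \in _)); last first.
  by move=> _; apply: ideal_gen0.
move=> /Pf /PG[a [au Ga]]; rewrite -(submK au) mpolyXD -mul_mpolyC mulrA.
exact: ideal_genM.
Qed.

Lemma lex_lead_binomial (a b : 'X_{1..N}) :
  lex_lt b a -> lex_lead ('X_[a] - 'X_[b] : S) a.
Proof.
move=> ba; have ab : b != a.
  apply: contraTneq ba => ->; apply/existsP => -[k].
  by rewrite ltnn.
split.
  by rewrite mcoeff_msupp mcoeffB !mcoeffX eqxx (negbTE ab) subr0 oner_eq0.
move=> c /msuppB_le; rewrite mem_cat !msuppX !inE => /orP[->//|/eqP->] _.
exact: ba.
Qed.

End IdealGen.

Section EdgeIdeal.
Local Open Scope ring_scope.
Variables (K : fieldType) (v : nat) (e : rel 'I_v).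
Notation S := {mpoly K[v + v]}.
Notation J := (binomial_edge_ideal K v e).
Notation X := (lshift v).
Notation Y := (@rshift v v).
Implicit Types (a u : 'X_{1..v + v}) (f : S).

(** For a vertex cover W, every edge binomial lies in the monomial prime ideal
    generated by the variables of the vertices of W. *)
Lemma edge_cover (W : pred 'I_v) f :
    (forall i j, e i j -> W i || W j) -> J f ->
  {in msupp f, forall u, exists2 i, W i & (0 < u (X i))%N || (0 < u (Y i))%N}.
Proof.
move=> cov Jf.
pose P u := [exists i, W i && ((0 < u (X i))%N || (0 < u (Y i))%N)].
have Pf : mono_ideal P f.
  apply: ideal_gen_mono Jf => [u w|g [i [j [/cov eij _ ->]]]].
    case/existsP => i /andP[Wi ui]; apply/existsP; exists i.
    by rewrite Wi !mnmDE !addn_gt0; case/orP: ui => ->; rewrite !orbT.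
  rewrite /xvar /yvar -!mpolyXD => u /msuppB_le.
  rewrite mem_cat !msuppX !inE => /orP[] /eqP->;
    case/orP: eij => Wi; apply/existsP; [exists i|exists j|exists i|exists j];
    by rewrite Wi !mnmDE !mnmE !eqxx ?orbT ?addn_gt0 //= ?orbT.
by move=> u /Pf /existsP[i /andP[Wi ui]]; exists i.
Qed.

(** A monomial a divisible by no x_i y_j with i < j is the least one in its toric
    fiber.  If the first difference of u and a were [u (X i) < a (X i)], then
    no y_j with j > i would occur in a, so u could not make up for the loss in
    the x-degree at any later index. *)
Lemma fiber_min a u :
    (forall i j : 'I_v, (i < j)%N -> ~~ ((0 < a (X i)) && (0 < a (Y j)))%N) ->
    (\sum_i u (X i) = \sum_i a (X i))%N ->
    (forall i, u (X i) + u (Y i) = a (X i) + a (Y i))%N ->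
  ~~ lex_lt u a.
Proof.
move=> std eX eXY; apply/existsP => -[k]; case: (split_ordP k) => i ->.
- case/andP=> ui /forallP lt_i.
  have : (\sum_i u (X i) < \sum_i a (X i))%N; last by rewrite eX ltnn.
  rewrite (bigD1 i) // [in ltnRHS](bigD1 i) //= -addSn leq_add //.
  apply: leq_sum => l li; have [il|/ltnW il|le] := ltngtP i l.
  + have := std i l il; rewrite (leq_ltn_trans _ ui) //= -eqn0Ngt => /eqP al.
    by have := eXY l; rewrite al addn0 => <-; apply: leq_addr.
  + have := lt_i (X l); rewrite /= ltn_neqAle il andbT.
    by rewrite -(inj_eq val_inj) in li; rewrite li /= => /eqP ->.
  + by rewrite (val_inj le) eqxx in li.
- case/andP=> ui /forallP lt_i; have := lt_i (X i); rewrite /= ltn_addr //=.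
  by move=> /eqP uX; have := eXY i; rewrite uX => /addnI ue; rewrite ue ltnn in ui.
Qed.

(** The parametrisation x_i -> s z_i, y_i -> z_i, with s the variable of index 0,
    whose kernel contains all the 2-minors. *)
Definition toric_exp (k : 'I_(v + v)) : 'X_{1..v.+1} :=
  match split k with
  | inl i => (U_(ord0) + U_(lift ord0 i))%MM
  | inr i => U_(lift ord0 i)%MM
  end.

Definition toric : S -> {mpoly K[v.+1]} :=
  mmap (@mpolyC v.+1 K) (fun k => 'X_[toric_exp k]).

Definition toric_mnm u : 'X_{1..v.+1} := (\sum_k toric_exp k *+ u k)%MM.

Lemma toricE f :
  toric f = \sum_(u <- msupp f) f@_u *: 'X_[toric_mnm u].
Proof.
apply: eq_bigr => u _; rewrite /mmap1 mprodXnE mul_mpolyC; congr (_ *: 'X_[_]).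
Qed.

Lemma toric_mnm0 u : toric_mnm u ord0 = (\sum_i u (X i))%N.
Proof.
rewrite mnm_sumE big_split_ord /= [X in (_ + X)%N]big1 ?addn0; last first.
  by move=> i _; rewrite mulmnE /toric_exp (unsplitK (inr i)) mnm1E.
apply: eq_bigr => i _; rewrite mulmnE /toric_exp (unsplitK (inl i)).
by rewrite mnmDE !mnm1E eqxx addn0 mul1n.
Qed.

Lemma toric_mnmS u i : toric_mnm u (lift ord0 i) = (u (X i) + u (Y i))%N.
Proof.
rewrite mnm_sumE big_split_ord /=; congr addn; rewrite (bigD1 i) //= big1.
- rewrite addn0 mulmnE /toric_exp (unsplitK (inl i)).
  by rewrite mnmDE !mnm1E eqxx mul1n.
- move=> j ji; rewrite mulmnE /toric_exp (unsplitK (inl j)) mnmDE !mnm1E.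
  by rewrite (inj_eq lift_inj) (negbTE ji).
- rewrite addn0 mulmnE /toric_exp (unsplitK (inr i)).
  by rewrite !mnm1E eqxx mul1n.
- move=> j ji; rewrite mulmnE /toric_exp (unsplitK (inr j)) !mnm1E.
  by rewrite (inj_eq lift_inj) (negbTE ji).
Qed.

Lemma toric_kernel f : J f -> toric f = 0.
Proof.
move=> [r [c [g [gE ->]]]]; rewrite /toric raddf_sum big1 // => k _ /=.
have [i [j [_ _ ->]]] := gE k; rewrite rmorphM rmorphB !rmorphM /=.
rewrite /xvar /yvar !mmapX !mmap1U /toric_exp.
rewrite !(unsplitK (inl _)) !(unsplitK (inr _)) -!mpolyXD.
rewrite -!addmA [(U_(lift ord0 j) + _)%MM]addmC subrr.
by rewrite mulr0.
Qed.

(** Otherwise a would be the least monomial in its toric fiber; being the largest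
    one in f, it would be the only one of f in that fiber, and its image in
    [toric f = 0] could not cancel. *)
Lemma lead_inversion f a : J f -> lex_lead f a ->
  exists i j : 'I_v, [/\ (i < j)%N, (0 < a (X i))%N & (0 < a (Y j))%N].
Proof.
move=> Jf [af lead].
have [/existsP[i /existsP[j /and3P[]]]|std] :=
  boolP [exists i : 'I_v, exists j : 'I_v,
    [&& (i < j)%N, (0 < a (X i))%N & (0 < a (Y j))%N]].
  by exists i, j.
have {}std (i j : 'I_v) : (i < j)%N -> ~~ ((0 < a (X i)) && (0 < a (Y j)))%N.
  move=> ij; apply: contra std => h.
  by apply/existsP; exists i; apply/existsP; exists j; rewrite ij.
have := congr1 (mcoeff (toric_mnm a)) (toric_kernel Jf).
rewrite toricE raddf_sum mcoeff0 /= (big_rem a) //= mcoeffZ mcoeffX eqxx mulr1.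
rewrite big_seq big1 ?addr0 => [/eqP|u].
  by move: af; rewrite mcoeff_msupp => /negbTE ->.
rewrite mem_rem_uniq ?msupp_uniq // inE => /andP[ua uf].
rewrite mcoeffZ mcoeffX; case: eqP => [eua|]; last by rewrite mulr0.
have /negP[] : ~~ lex_lt u a; last exact: lead.
apply: fiber_min => //; first by rewrite -!toric_mnm0 eua.
by move=> i; rewrite -!toric_mnmS eua.
Qed.

End EdgeIdeal.

(** * The initial ideal of the complete bipartite graph *)

(** Labels of the generators: [inl (i, j)] stands for x_i y_j, and
    [inr (k, i, j)] for the cubic of the path i, k, j. *)
Local Notation gens v := (('I_v * 'I_v) + ('I_v * 'I_v * 'I_v))%type.

Section Bipartite.
Variables (m n : nat).
Notation v := (m + n).
Notation X := (lshift v).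
Notation Y := (@rshift v v).
Implicit Types (i j k : 'I_v) (x y : gens v).

(** A path i, k, j with i and j on the same side has k larger than both when k is
    on the right side, and smaller than both when it is on the left side. *)
Definition third k : 'I_(v + v) := if k < m then Y k else X k.

Definition gen_valid x : bool :=
  match x with
  | inl (i, j) => i < m <= j
  | inr (k, i, j) => [&& i < j, (i < m) == (j < m) & (k < m) != (i < m)]
  end.

Definition gen_supp x : {set 'I_(v + v)} :=
  match x with
  | inl (i, j) => [set X i; Y j]
  | inr (k, i, j) => [set X i; Y j; third k]
  end.

(** The quadrics come first, in lexicographic order of (i, j); then the cubics, in
    lexicographic order of (k, i, j). *)
Definition gen_key x : nat :=
  match x with
  | inl (i, j) => i * v + j
  | inr (k, i, j) => v * v + ((k * v + i) * v + j)
  end.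

Definition var_set (A B : pred nat) : {set 'I_(v + v)} :=
  [set l | match split l with inl i => A i | inr i => B i end].

(** The variables generating the colon ideal of the earlier generators by x.  For
    a cubic with k on the right, x_a for a < i and y_b for i < b < j come
    from the cubics with the same k, the x_a for a on the right from those
    with smaller k, and the y_b for b on the right from the quadrics x_i y_b.
    For k on the left the quadrics are the x_a y_j with a on the left, and
    together with the x_a for a on the right below i these are all the x_a
    with a < i; the y_b with b < k come from the smaller k. *)
Definition gen_colon x : {set 'I_(v + v)} :=
  match x with
  | inl (i, j) => var_set (fun a => a < i) (fun b => m <= b < j)
  | inr (k, i, j) =>
      if k < m then var_set (fun a => a < i) (fun b => (b < k) || (i < b < j))
      else var_set (fun a => (a < i) || (m <= a < k))
                   (fun b => (m <= b) || (i < b < j))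
  end.

Lemma eq_XX i j : (X i == X j) = (i == j).
Proof. exact: (inj_eq (@lshift_inj _ _)). Qed.

Lemma eq_YY i j : (Y i == Y j) = (i == j).
Proof. exact: (inj_eq (@rshift_inj _ _)). Qed.

Lemma eq_XY i j : (X i == Y j) = false.
Proof. exact: eq_lrshift. Qed.

Lemma eq_YX i j : (Y i == X j) = false.
Proof. exact: eq_rlshift. Qed.

Lemma var_setX A B i : (X i \in var_set A B) = A i.
Proof. by rewrite inE (unsplitK (inl i)). Qed.

Lemma var_setY A B i : (Y i \in var_set A B) = B i.
Proof. by rewrite inE (unsplitK (inr i)). Qed.

Lemma card_var_set A B :
  #|var_set A B| = \sum_(i < v) A i + \sum_(i < v) B i.
Proof.
rewrite -sum1_card big_mkcond big_split_ord /=.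
congr addn; apply: eq_bigr => i _; rewrite ?var_setX ?var_setY;
  [by case: (A i)|by case: (B i)].
Qed.

Definition supp_simpl :=
  (var_setX, var_setY, inE, eq_XX, eq_YY, eq_XY, eq_YX, negb_or, orbF, orbT).

Lemma ltn_digits d a b a' b' : b < d -> b' < d ->
  (a' * d + b' < a * d + b) = (a' < a) || ((a' == a) && (b' < b)).
Proof.
move=> bd b'd; case: (ltngtP a' a) => [lt|lt|->] /=.
- by have : a'.+1 * d <= a * d; [rewrite leq_mul2r lt orbT|rewrite mulSn; lia].
- by have : a.+1 * d <= a' * d; [rewrite leq_mul2r lt orbT|rewrite mulSn; lia].
- by rewrite ltn_add2l.
Qed.

Lemma digits_bound d a b c : a < c -> b < d -> a * d + b < c * d.
Proof.
by move=> ac bd; have : a.+1 * d <= c * d; [rewrite leq_mul2r ac orbT|rewrite mulSn; lia].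
Qed.

Definition gen_lt y x : bool :=
  match y, x with
  | inl (i', j'), inl (i, j) => (i' < i) || ((i' == i) && (j' < j))
  | inl _, inr _ => true
  | inr _, inl _ => false
  | inr (k', i', j'), inr (k, i, j) =>
      [|| k' < k, (k' == k) && (i' < i) | [&& k' == k, i' == i & j' < j]]
  end.

Lemma gen_keyE y x : (gen_key y < gen_key x) = gen_lt y x.
Proof.
case: y x => [[i' j']|[[k' i'] j']] [[i j]|[[k i] j]] /=.
- by rewrite ltn_digits.
- by apply: leq_trans (leq_addr _ _); apply: digits_bound.
- apply/negbTE; rewrite -leqNgt; apply: leq_trans (leq_addr _ _).
  by rewrite ltnW //; apply: digits_bound.
- rewrite ltn_add2l ltn_digits // ltn_digits // !(inj_eq val_inj).
  have -> : (k' * v + i' == k * v + i) = (k' == k) && (i' == i).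
    apply/eqP/andP => [e|[/eqP-> /eqP->]//].
    have := ltn_digits k k' (ltn_ord i) (ltn_ord i').
    have := ltn_digits k' k (ltn_ord i') (ltn_ord i).
    rewrite e ltnn -!(inj_eq val_inj) /=; lia.
  by rewrite -orbA -andbA.
Qed.

Lemma gen_key_inj : injective gen_key.
Proof.
move=> x y e; have := gen_keyE x y; have := gen_keyE y x; rewrite e ltnn.
case: x y {e} => [[i j]|[[k i] j]] [[i' j']|[[k' i'] j']] //=.
  rewrite -!(inj_eq val_inj) /= => h1 h2.
  have ei : i = i' by apply: val_inj => /=; lia.
  by have -> : j = j' by [apply: val_inj => /=; lia]; rewrite ei.
rewrite -!(inj_eq val_inj) /= => h1 h2.
have ek : k = k' by apply: val_inj => /=; lia.
have ei : i = i' by apply: val_inj => /=; lia.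
by have -> : j = j' by [apply: val_inj => /=; lia]; rewrite ek ei.
Qed.

Lemma card_gen_supp x : gen_valid x ->
  #|gen_supp x| = if x is inl _ then 2 else 3.
Proof.
case: x => [[i j] _|[[k i] j] /= /and3P[_ eij nki]] /=.
  by rewrite cards2 eq_XY.
rewrite setUC cardsU1 cards2 eq_XY /third; case: ifP nki eij => km.
  by rewrite !supp_simpl /= -(inj_eq (@ord_inj _)) => ? ?; lia.
by rewrite !supp_simpl /= -(inj_eq (@ord_inj _)) => ? ?; lia.
Qed.

(** In general the variable of y at the first index where y and x differ works.
    The exceptions are a quadric y before a cubic x, and two cubics whose third
    vertices are on different sides; there x_i' with i' on the left, or y_j'
    with j' on the right, belongs to the colon of x. *)
Lemma gen_colon_sep x y : gen_valid x -> gen_valid y -> gen_lt y x ->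
  exists l, [/\ l \in gen_supp y, l \notin gen_supp x & l \in gen_colon x].
Proof.
case: y x => [[i' j']|[[k' i'] j']] [[i j]|[[k i] j]] //=.
- move=> ij ij' /orP[lt|/andP[_ lt]].
    by exists (X i'); rewrite !supp_simpl eqxx -?val_eqE /=; split=> //; lia.
  by exists (Y j'); rewrite !supp_simpl eqxx -?val_eqE /=; split=> //; lia.
- move=> vx ij' _; rewrite /third; case: ifP => km.
    by exists (X i'); rewrite !supp_simpl eqxx -?val_eqE /=; split=> //; lia.
  by exists (Y j'); rewrite !supp_simpl eqxx -?val_eqE /=; split=> //; lia.
- move=> vx vy; have [ltk _|gek /=] := ltnP k' k.
    rewrite /third; case: (ltnP k m) => km; case: (ltnP k' m) => k'm.
    + by exists (Y k'); rewrite !supp_simpl eqxx -?val_eqE /=; split=> //; lia.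
    + lia.
    + by exists (Y j'); rewrite !supp_simpl eqxx -?val_eqE /=; split=> //; lia.
    + by exists (X k'); rewrite !supp_simpl eqxx -?val_eqE /=; split=> //; lia.
  case/orP=> [/andP[/eqP ek lt]|/and3P[/eqP ek /eqP ei lt]]; subst k'.
    exists (X i'); rewrite /third; case: ifP => km;
      by rewrite !supp_simpl eqxx -?val_eqE /=; split=> //; lia.
  subst i'; exists (Y j'); rewrite /third; case: ifP => km;
    by rewrite !supp_simpl eqxx -?val_eqE /=; split=> //; lia.
Qed.

Lemma sub_supp2 (A : {set 'I_(v + v)}) a b :
  a \in A -> b \in A -> [set a; b] \subset A.
Proof. by rewrite subUset !sub1set => -> ->. Qed.

Lemma sub_supp3 (A : {set 'I_(v + v)}) a b c :
  a \in A -> b \in A -> c \in A -> [set a; b; c] \subset A.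
Proof. by rewrite subUset => aA bA; rewrite sub1set sub_supp2. Qed.

(** The earlier generator is x with one of its vertices replaced by that of l,
    or the quadric formed by l and one of x_i and y_j. *)
Lemma gen_colon_swap x l : gen_valid x -> l \in gen_colon x ->
  exists y, [/\ gen_valid y, gen_lt y x & gen_supp y \subset l |: gen_supp x].
Proof.
case: x => [[i j]|[[k i] j]] /= vx.
  case: (split_ordP l) => a ->; rewrite !supp_simpl => la.
    exists (inl (a, j)); split=> /=; [lia|by rewrite la|].
    by apply: sub_supp2; rewrite !supp_simpl !eqxx ?orbT.
  exists (inl (i, a)); split=> /=; [lia|by rewrite eqxx ltnn; lia|].
  by apply: sub_supp2; rewrite !supp_simpl !eqxx ?orbT.
have drop_third (a : 'I_v) : (a < m) = (k < m) -> a < k -> l = third a ->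
  exists y, [/\ gen_valid y, gen_lt y (inr (k, i, j))
              & gen_supp y \subset l |: [set X i; Y j; third k]].
  move=> am ak ->; exists (inr (a, i, j)); split=> /=; [lia|by rewrite ak|].
  by apply: sub_supp3; rewrite !supp_simpl ?eqxx ?orbT.
have drop_x (a : 'I_v) : a < i -> (a < m) = (i < m) -> l = X a ->
  exists y, [/\ gen_valid y, gen_lt y (inr (k, i, j))
              & gen_supp y \subset l |: [set X i; Y j; third k]].
  move=> ai am ->; exists (inr (k, a, j)); split=> /=; [lia|by rewrite eqxx ai orbT|].
  by apply: sub_supp3; rewrite !supp_simpl ?eqxx ?orbT.
have drop_y (a : 'I_v) : i < a < j -> l = Y a ->
  exists y, [/\ gen_valid y, gen_lt y (inr (k, i, j))
              & gen_supp y \subset l |: [set X i; Y j; third k]].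
  move=> ai ->; exists (inr (k, i, a)); split=> /=; [lia|rewrite !eqxx; lia|].
  by apply: sub_supp3; rewrite !supp_simpl ?eqxx ?orbT.
case: ifP => km; case: (split_ordP l) => a la;
  rewrite [in X in X -> _]la !supp_simpl => ha.
- have [am|am] := ltnP a m; last by apply: drop_x la; lia.
  exists (inl (a, j)); split=> //=; first lia.
  by apply: sub_supp2; rewrite la !supp_simpl ?eqxx ?orbT.
- case/orP: ha => ha; last exact: drop_y la.
  by apply: (drop_third a); rewrite ?la /third; [lia|lia|case: ifP => //; lia].
- case/orP: ha => ha; first by apply: drop_x la; lia.
  by apply: (drop_third a); rewrite ?la /third; [lia|lia|case: ifP => //; lia].
- case/orP: ha => ha; last exact: drop_y la.
  exists (inl (i, a)); split=> //=; first lia.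
  by apply: sub_supp2; rewrite la !supp_simpl ?eqxx ?orbT.
Qed.

Lemma resolved_bipartite (K : fieldType) :
  resolved (@mono_ideal K (v + v)
      (fun u => [exists x, gen_valid x && (gen_supp x \subset mnm_supp u)]))
    (fun p d => \sum_(x | gen_valid x)
       (d == p + #|gen_supp x|) * 'C(#|gen_colon x|, p)).
Proof.
apply: (linear_quotients K (key := gen_key)) => [x y _ _|x y vx vy|x y vx vy|x vx l lx].
- exact: gen_key_inj.
- rewrite gen_keyE !card_gen_supp //.
  by case: x y {vx vy} => [[? ?]|[[? ?] ?]] [[? ?]|[[? ?] ?]].
- by rewrite gen_keyE; apply: gen_colon_sep.
- have [y [vy lt_y sub]] := gen_colon_swap vx lx.
  by exists y; rewrite gen_keyE.
Qed.

Lemma sqfree_mnm2 a b : a != b ->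
  sqfree_mnm [set a; b] = (U_(a) + U_(b))%MM :> 'X_{1..v + v}.
Proof.
move=> ab; apply/mnmP => l; rewrite mnmDE !mnmE !inE ![l == _]eq_sym.
by case: (eqVneq a l) => [<-|_] /=; [rewrite eq_sym (negbTE ab)|case: (b == l)].
Qed.

Lemma sqfree_mnm3 a b c : a != b -> a != c -> b != c ->
  sqfree_mnm [set a; b; c] = (U_(a) + U_(b) + U_(c))%MM :> 'X_{1..v + v}.
Proof.
move=> ab ac bc; apply/mnmP => l; rewrite !mnmDE !mnmE !inE ![l == _]eq_sym.
case: (eqVneq a l) => [<-|_] /=.
  by rewrite ![_ == a]eq_sym (negbTE ab) (negbTE ac).
by case: (eqVneq b l) => [<-|_] /=; [rewrite eq_sym (negbTE bc)|case: (c == l)].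
Qed.

Lemma lex_lt_swap i j (w : 'X_{1..v + v}) : i < j ->
  lex_lt (U_(X j) + U_(Y i) + w)%MM (U_(X i) + U_(Y j) + w)%MM.
Proof.
move=> ij; have ji : (j == i) = false by rewrite -val_eqE /=; lia.
apply/existsP; exists (X i); rewrite !mnmDE !mnm1E !eq_YX eq_XX ji eqxx.
rewrite add0n addn0 add1n ltnSn /=; apply/forallP => l; apply/implyP.
case: (split_ordP l) => h -> /= hi; last by (have := ltn_ord i; lia).
by rewrite !mnmDE !mnm1E !eq_YX !eq_XX -!val_eqE /=; lia.
Qed.

Section Initial.
Local Open Scope ring_scope.
Variable K : fieldType.
Notation J := (binomial_edge_ideal K v (complete_bipartite m n)).
Notation x_ := (@xvar K v).
Notation y_ := (@yvar K v).

Lemma bipartite_mem (c : {mpoly K[v + v]}) i j : (i < m <= j)%N ->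
  J (c * (x_ i * y_ j - x_ j * y_ i)).
Proof.
move=> /andP[im mj]; apply: ideal_genM; exists i, j.
by rewrite /complete_bipartite im mj (leq_trans im mj).
Qed.

(** For the cubics, the Pluecker relation writes z_k times the minor on columns i
    and j as a combination of the minors of the two edges at k. *)
Lemma lead_gen x : gen_valid x ->
  exists2 f, J f & lex_lead f (sqfree_mnm (gen_supp x)).
Proof.
case: x => [[i j]|[[k i] j]] /= vx.
  have ij : (i < j)%N by lia.
  exists ('X_[U_(X i) + U_(Y j) + 0] - 'X_[U_(X j) + U_(Y i) + 0]).
    rewrite !addm0 !mpolyXD -[_ - _]mul1r; exact: bipartite_mem.
  rewrite sqfree_mnm2 ?eq_XY // -[X in lex_lead _ X]addm0.
  exact/lex_lead_binomial/lex_lt_swap.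
have /and3P[ij _ _] := vx.
exists ('X_[U_(X i) + U_(Y j) + U_(third k)] - 'X_[U_(X j) + U_(Y i) + U_(third k)]).
  rewrite !mpolyXD -[X in X - _]/(x_ i * y_ j * _) -[X in _ - X]/(x_ j * y_ i * _).
  rewrite /third; case: ifP => km.
    have -> : x_ i * y_ j * 'X_(Y k) - x_ j * y_ i * 'X_(Y k) =
      y_ i * (x_ k * y_ j - x_ j * y_ k) + (- y_ j) * (x_ k * y_ i - x_ i * y_ k).
      by rewrite -[X in _ * X - _]/(y_ k) -[X in _ - _ * X]/(y_ k); ring.
    by apply: ideal_genD; apply: bipartite_mem; lia.
  have -> : x_ i * y_ j * 'X_(X k) - x_ j * y_ i * 'X_(X k) =
    x_ j * (x_ i * y_ k - x_ k * y_ i) + (- x_ i) * (x_ j * y_ k - x_ k * y_ j).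
    by rewrite -[X in _ * X - _]/(x_ k) -[X in _ - _ * X]/(x_ k); ring.
  by apply: ideal_genD; apply: bipartite_mem; lia.
rewrite sqfree_mnm3; first exact/lex_lead_binomial/lex_lt_swap.
- by rewrite eq_XY.
- by rewrite /third; case: ifP => km; rewrite ?eq_XY ?eq_XX -?val_eqE /=; lia.
- by rewrite /third; case: ifP => km; rewrite ?eq_YX ?eq_YY -?val_eqE /=; lia.
Qed.

(** A leading monomial a contains x_i y_j with i < j.  If i and j are on different
    sides, this is a quadric.  If they are on the same side, a also contains a
    variable of the other side, which completes x_i y_j to a cubic, or forms a
    quadric with x_i or y_j. *)
Lemma initial_bipartite f : initial_ideal J f <->
  mono_ideal
    (fun u => [exists x, gen_valid x && (gen_supp x \subset mnm_supp u)]) f.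
Proof.
split; last first.
  apply: mono_ideal_gen => u /existsP[x /andP[vx xu]].
  exists (sqfree_mnm (gen_supp x)); rewrite sqfree_mnm_le xu; split=> //.
  by have [g Jg lead] := lead_gen vx; exists g, (sqfree_mnm (gen_supp x)).
apply: ideal_gen_mono => [u w /existsP[x /andP[vx xu]]|g [h [a [Jh lead ->]]]].
  apply/existsP; exists x; rewrite vx; apply: subset_trans xu _.
  by apply/subsetP => l; rewrite !inE mnmDE addn_gt0 => ->; rewrite orbT.
have [ah _] := lead; move=> b; rewrite msuppX inE => /eqP -> {b}.
have covA i j : complete_bipartite m n i j -> (i < m)%N || (j < m)%N.
  by case/orP=> /andP[-> _]; rewrite ?orbT.
have covB i j : complete_bipartite m n i j -> (m <= i)%N || (m <= j)%N.
  by case/orP=> /andP[_ ->]; rewrite ?orbT.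
have [k km ak] := edge_cover covA Jh ah.
have [l ml al] := edge_cover covB Jh ah.
rewrite /= in km ml.
have [i [j [ij xi yj]]] := lead_inversion Jh lead.
have edge (b c : 'I_v) : (b < m <= c)%N -> (0 < a (X b))%N -> (0 < a (Y c))%N ->
  [exists x, gen_valid x && (gen_supp x \subset mnm_supp a)].
  move=> vbc ab ac; apply/existsP; exists (inl (b, c)); rewrite /= vbc.
  by apply: sub_supp2; rewrite inE.
have tri (b : 'I_v) : gen_valid (inr (b, i, j)) -> (0 < a (third b))%N ->
  [exists x, gen_valid x && (gen_supp x \subset mnm_supp a)].
  move=> vx ab; apply/existsP; exists (inr (b, i, j)); rewrite vx.
  by apply: sub_supp3; rewrite inE.
have [im|mi] := ltnP i m; have [jm|mj] := ltnP j m.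
- case/orP: al => al; last by apply: edge xi al; rewrite im.
  by apply: (tri l); rewrite /= /third; [lia|case: ifP => //; lia].
- by apply: edge xi yj; rewrite im.
- lia.
- case/orP: ak => ak; first by apply: edge ak yj; rewrite km.
  by apply: (tri k); rewrite /= /third ?km //; lia.
Qed.

End Initial.

End Bipartite.

(** * Counting generators and colon variables *)

Lemma sum_interval d a b : b <= d -> \sum_(i < d) (a <= i < b) = b - a.
Proof.
move=> bd; have -> : b = minn b d by lia.
move: b {bd} => b; elim: d => [|d IH]; first by rewrite big_ord0; lia.
rewrite big_ord_recr /= (_ : \sum_(i < d) _ = minn b d - a); last first.
  by rewrite -IH; apply: eq_bigr => i _; have := ltn_ord i; lia.
lia.
Qed.

Lemma sum_edges m n (F : nat -> nat -> nat) :
  \sum_(1 <= i < m.+1) \sum_(m.+1 <= j < (m + n).+1) F i j =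
  \sum_(i < m) \sum_(j < n) F i.+1 (m + j).+1.
Proof.
have shift (G : nat -> nat) :
    \sum_(m.+1 <= j < (m + n).+1) G j = \sum_(j < n) G (m + j).+1.
  rewrite -addSn -[m.+1 in X in bigop _ X]add0n big_addn addKn big_mkord.
  by apply: eq_bigr => j _; rewrite addnC.
by rewrite big_add1 big_mkord; apply: eq_bigr => i _; apply: shift.
Qed.

Lemma sum_triples d e (F : nat -> nat -> nat) :
  \sum_(1 <= i < d.+1) \sum_(i.+1 <= j < d.+1) \sum_(1 <= k < e.+1) F k j =
  \sum_(k < e) \sum_(i < d) \sum_(j < d) (i < j) * F k.+1 j.+1.
Proof.
rewrite [RHS]exchange_big /= big_add1 big_mkord; apply: eq_bigr => i _.
rewrite [RHS]exchange_big /= big_add1 big_geq_mkord /= big_mkcond /=.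
apply: eq_bigr => j _; rewrite big_add1 big_mkord; case: ifP => ij.
  by apply: eq_bigr => k _; rewrite mul1n.
by rewrite big1.
Qed.

Section Counting.
Variables (m n : nat).
Notation v := (m + n).

Lemma sum_gens (G : gens v -> nat) :
  \sum_(x | gen_valid x) G x =
  \sum_(i < m) \sum_(j < n) G (inl (lshift n i, rshift m j))
  + (\sum_(k < m) \sum_(i < n) \sum_(j < n)
       (i < j) * G (inr (lshift n k, rshift m i, rshift m j))
     + \sum_(k < n) \sum_(i < m) \sum_(j < m)
       (i < j) * G (inr (rshift m k, lshift n i, lshift n j))).
Proof.
pose H x := gen_valid x * G x.
have -> : \sum_(x | gen_valid x) G x = \sum_x H x.
  by rewrite big_mkcond; apply: eq_bigr => x _; rewrite /H; case: ifP; rewrite ?mul1n.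
rewrite big_sumType /=; congr addn.
  rewrite (eq_bigr (fun p => H (inl (p.1, p.2)))); last by case.
  rewrite -(pair_bigA _ (fun i j => H (inl (i, j)))) /= big_split_ord /=.
  rewrite [X in _ + X]big1 ?addn0 => [|i _].
    apply: eq_bigr => i _; rewrite big_split_ord /= big1 ?add0n => [|j _].
      by apply: eq_bigr => j _; rewrite /H /= ltn_ord leq_addr mul1n.
    by rewrite /H /= [m <= j]leqNgt !ltn_ord.
  by rewrite big1 // => j _; rewrite /H /= ltnNge leq_addr.
rewrite (eq_bigr (fun p => H (inr (p.1, p.2)))); last by case.
rewrite -(pair_bigA _ (fun q j => H (inr (q, j)))) /=.
rewrite (eq_bigr (fun q => \sum_j H (inr (q.1, q.2, j)))); last by case.
rewrite -(pair_bigA _ (fun k i => \sum_j H (inr (k, i, j)))) /= big_split_ord /=.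
congr addn; apply: eq_bigr => k _; rewrite big_split_ord /=.
  rewrite big1 ?add0n => [|i _]; last first.
    by rewrite big1 // => j _; rewrite /H /= !ltn_ord /= !andbF.
  apply: eq_bigr => i _; rewrite big_split_ord /= big1 ?add0n => [|j _].
    apply: eq_bigr => j _; rewrite /H /= ltn_add2l !ltn_ord.
    by rewrite ![m + _ < m]ltnNge !leq_addr /= andbT.
  by rewrite /H /= ltn_ord [m + _ < m]ltnNge leq_addr /= andbF.
rewrite [X in _ + X]big1 ?addn0 => [|i _]; last first.
  by rewrite big1 // => j _; rewrite /H /= ![m + _ < m]ltnNge !leq_addr /= !andbF.
apply: eq_bigr => i _; rewrite big_split_ord /= [X in _ + X]big1 ?addn0 => [|j _].
  apply: eq_bigr => j _; rewrite /H /= !ltn_ord.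
  by rewrite ![m + _ < m]ltnNge !leq_addr /= andbT.
by rewrite /H /= ltn_ord [m + _ < m]ltnNge leq_addr /= andbF.
Qed.

Lemma card_colon (x : gens v) : gen_valid x ->
  #|gen_colon x| = match x with
    | inl (i, j) => i + (j - m)
    | inr (k, i, j) => if k < m then k + j - 1 else n + (k - m) + j - 1
    end.
Proof.
have union a b c d : (forall i : 'I_v, ~~ ((a <= i < b) && (c <= i < d))) ->
    b <= v -> d <= v ->
  \sum_(i < v) ((a <= i < b) || (c <= i < d)) = (b - a) + (d - c).
  move=> dis bv dv; rewrite -(sum_interval a bv) -(sum_interval c dv) -big_split.
  by apply: eq_bigr => i _ /=; have := dis i; lia.
have prefix b : b <= v -> \sum_(i < v) (i < b) = b.
  by move=> bv; rewrite -[RHS]subn0 -(sum_interval 0 bv).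
case: x => [[i j]|[[k i] j]] /= vx; have iv := ltn_ord i; have jv := ltn_ord j.
  by rewrite card_var_set prefix ?sum_interval //; lia.
have kv := ltn_ord k; case: ifP => km; rewrite card_var_set.
  rewrite prefix; last lia.
  by rewrite (union 0 k i.+1 j); [lia|move=> l; lia|lia|lia].
rewrite (union 0 i m k); [|by move=> l; lia|lia|lia].
rewrite (eq_bigr (fun l : 'I_v => ((m <= l < v) || (i.+1 <= l < j) : nat))).
  by rewrite union; [lia|move=> l; lia|lia|lia].
by move=> l _; rewrite ltn_ord andbT.
Qed.

Lemma sum_edge_gens t :
  \sum_(x : gens v | gen_valid x)
     (t + 2 == t + #|gen_supp x|) * 'C(#|gen_colon x|, t) =
  \sum_(1 <= i < m.+1) \sum_(m.+1 <= j < (m + n).+1) 'C(i + j - m - 2, t).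
Proof.
rewrite (eq_bigr (fun x : gens v => if x is inl (i, j) then 'C(i + (j - m), t) else 0)).
  rewrite sum_gens sum_edges -[RHS]addn0; congr addn.
    by apply: eq_bigr => i _; apply: eq_bigr => j _ /=; congr 'C(_, t); lia.
  have zero a b c : \sum_(k < a) \sum_(i < b) \sum_(j < c) (i < j) * 0 = 0.
    by apply: big1 => k _; apply: big1 => i _; apply: big1 => j _; rewrite muln0.
  by rewrite /= !zero.
case=> [[i j]|q] vx; rewrite card_gen_supp // eqn_add2l //.
by rewrite card_colon // mul1n.
Qed.

Lemma sum_triple_gens t :
  \sum_(x : gens v | gen_valid x)
     (t + 3 == t + #|gen_supp x|) * 'C(#|gen_colon x|, t) =
  \sum_(1 <= i < m.+1) \sum_(i.+1 <= j < m.+1) \sum_(1 <= k < n.+1)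
     'C(n + k + j - 3, t)
  + \sum_(1 <= i < n.+1) \sum_(i.+1 <= j < n.+1) \sum_(1 <= k < m.+1)
     'C(m + k + j - 3, t).
Proof.
rewrite (eq_bigr (fun x : gens v => if x is inr (k, i, j) then
    'C(if k < m then k + j - 1 else n + (k - m) + j - 1, t) else 0)); last first.
  case=> [q|[[k i] j]] vx; rewrite card_gen_supp // eqn_add2l //.
  by rewrite card_colon // mul1n.
rewrite sum_gens big1 ?add0n; last by move=> i _; rewrite big1.
rewrite addnC (sum_triples m n (fun k j => 'C(n + k + j - 3, t))).
rewrite (sum_triples n m (fun k j => 'C(m + k + j - 3, t))).
congr addn; apply: eq_bigr => k _; apply: eq_bigr => i _; apply: eq_bigr => j _ /=;
  congr (_ * 'C(_, t)).
  by rewrite ltnNge leq_addr /=; lia.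
by rewrite ltn_ord; lia.
Qed.

End Counting.

Theorem theorem2p2 (K : fieldType) (m n : nat) (hn : 1 <= n) (hmn : n <= m)
    (t : nat) :
  graded_betti
    (initial_ideal
      (binomial_edge_ideal K (m + n) (complete_bipartite m n)))
    t (t + 2)
    (\sum_(1 <= i < m.+1) \sum_(m.+1 <= j < (m + n).+1) 'C(i + j - m - 2, t))
  /\
  graded_betti
    (initial_ideal
      (binomial_edge_ideal K (m + n) (complete_bipartite m n)))
    t (t + 3)
    (if n == 1 then
       \sum_(1 <= i < m.+1) \sum_(i.+1 <= j < m.+1) \sum_(1 <= k < n.+1)
         'C(n + k + j - 3, t)
     else
       \sum_(1 <= i < m.+1) \sum_(i.+1 <= j < m.+1) \sum_(1 <= k < n.+1)
         'C(n + k + j - 3, t)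
       + \sum_(1 <= i < n.+1) \sum_(i.+1 <= j < n.+1) \sum_(1 <= k < m.+1)
         'C(m + k + j - 3, t)).
Proof.
have res := resolved_ext (fun f => iff_sym (initial_bipartite f))
  (fun p d => erefl) (resolved_bipartite m n K).
have betti := resolved_betti t _ res.
split; first by rewrite -sum_edge_gens; apply: betti.
rewrite [X in graded_betti _ _ _ X](_ : _ =
  \sum_(x : gens (m + n) | gen_valid x)
     (t + 3 == t + #|gen_supp x|) * 'C(#|gen_colon x|, t)); first exact: betti.
rewrite sum_triple_gens; case: eqP => // ->.
(* For n = 1 the second sum runs over the pairs of a one-element side. *)
by rewrite [X in _ + X]big_nat1 [X in _ + X]big_geq // addn0.
Qed.
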